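(* Let $m,n$ be positive integers, $U\subseteq\mathbb{R}^{m\times n}$ a non-empty open set, and $f_k:U\to\mathbb{R}^{m\times n}$, $k\ge1$, a sequence of injective continuous functions. Then $\bigcap_{k\ge1}f_k^{-1}(\mathscr{L}_{m,n})\cap\mathscr{L}_{m,n}$ is a dense $G_\delta$ subset of $U$; in particular there is a dense $G_\delta$ subset $\Omega$ of $U$ with $\Omega\subseteq\mathscr{L}_{m,n}$ and $f_k(A)\in\mathscr{L}_{m,n}$ for all $A\in\Omega$ and all $k\ge1$.
   Context: $\Vert\cdot\Vert$ is the supremum norm; a real $m\times n$ matrix $A$ is a Liouville matrix if $A\mathbf{q}-\mathbf{p}\neq\mathbf{0}$ for all nonzero $(\mathbf{q},\mathbf{p})\in\mathbb{Z}^n\times\mathbb{Z}^m$ and for every $N$ there exist $\mathbf{p}\in\mathbb{Z}^m$, $\mathbf{q}\in\mathbb{Z}^n\setminus\{\mathbf{0}\}$ with $\Vert A\mathbf{q}-\mathbf{p}\Vert<\Vert\mathbf{q}\Vert^{-N}$; $\mathscr{L}_{m,n}$ is the set of these. $\mathbb{R}^{m\times n}$ carries the topology of $\mathbb{R}^{mn}$. *)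

(* Defs.v *)
From HB Require Import structures.
From mathcomp Require Import all_boot all_order all_algebra.
From mathcomp Require Import all_classical all_reals all_analysis.
Set Implicit Arguments. Unset Strict Implicit. Unset Printing Implicit Defensive.
Import Order.TTheory GRing.Theory Num.Theory.
Import numFieldNormedType.Exports.
Local Open Scope classical_set_scope.
Local Open Scope ring_scope.

Definition intvec (R : realType) (k : nat) (v : 'cV[int]_k) : 'cV[R]_k :=
  map_mx (fun z : int => z%:~R) v.

(* Liouville matrix: sup norm = mx_norm (max of absolute values of entries). *)
Definition Liouville (R : realType) (m n : nat) (A : 'M[R]_(m, n)) : Prop :=
  (forall (q : 'cV[int]_n) (p : 'cV[int]_m), (q != 0 \/ p != 0) ->
      A *m intvec R q - intvec R p != 0) /\
  (forall N : nat, exists (p : 'cV[int]_m) (q : 'cV[int]_n),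
      q != 0 /\
      mx_norm (A *m intvec R q - intvec R p) < (mx_norm (intvec R q)) ^- N).

Definition Liouville_set (R : realType) (m n : nat) : set 'M[R]_(m, n) :=
  [set A | Liouville A].

Definition Gdelta_in (T : topologicalType) (U S : set T) : Prop :=
  exists O : nat -> set T, (forall i, open (O i)) /\
    S = U `&` \bigcap_(i in [set: nat]) O i.

Definition dense_in (T : topologicalType) (U S : set T) : Prop :=
  S `<=` U /\ U `<=` closure S.

(* Main.v *)
Require Import Defs.
From HB Require Import structures.
From mathcomp Require Import all_boot all_order all_algebra.
From mathcomp Require Import all_classical all_reals all_analysis.
From mathcomp Require Import zify ring lra.
Import Order.TTheory GRing.Theory Num.Theory.
Import numFieldNormedType.Exports.
Local Open Scope classical_set_scope.
Local Open Scope ring_scope.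
Set Implicit Arguments. Unset Strict Implicit. Unset Printing Implicit Defensive.

(** The set of Liouville matrices is a countable intersection of open sets W, so
by Baire's theorem it is enough that f(B) meets W for each such W, each non-empty
open B inside U and each continuous injective f (the identity included).  Every
W contains translated lattices C + (1/s) Z^(m x n) with s arbitrarily large: for
the approximation conditions take C = 0, and for A q <> p take a C for which
(C q)_0 is an odd multiple of 1/(2s).  Hence it suffices that the image of a cube
under a continuous injection meets every sufficiently fine translated lattice.

This replaces invariance of domain and is proved as follows.  Rescale so that the
lattice is the integer one and opposite faces of the cube have images at distance
at least 1.  If the image misses the lattice, then, by compactness, at each point
some coordinate is at distance at least d from the integers.  By the pigeonhole
principle, with N = mn coordinates, one of the N intervals [l d/N, (l+1) d/N)
contains no distance of a coordinate to the integers; colour the point by l.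
Points of a fixed colour l split into cells, according to which coordinates are
closer than l d/N to an integer, and between or near which integers they lie.
Neighbouring points of the same colour lie in the same cell, and cells have
diameter less than 1.  This contradicts the Lebesgue covering theorem: in a
colouring of the grid {0..k}^N with N colours, some cell of some colour i joins
the two i-th faces.  The latter follows from a discrete Poincare-Miranda theorem,
which comes from evaluating mod 2 the top-dimensional cup product of the
coboundaries of N functions on a cubical lattice. *)

(** * A discrete Poincare-Miranda theorem *)

Section CupProducts.
Variable I : finType.
Implicit Types (x y : I -> nat) (J : {set I}) (i j l : I).

Definition step j x : I -> nat := fun i => (x i + (i == j))%N.

Definition upd j (a : nat) x : I -> nat := fun i => if i == j then a else x i.

Lemma stepC i j x : step i (step j x) = step j (step i x).
Proof. by apply/funext => l; rewrite /step addnAC. Qed.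

Lemma step_neq i j x : i != j -> step j x i = x i.
Proof. by rewrite /step => /negPf ->; rewrite addn0. Qed.

Lemma upd_eq j a x : upd j a x j = a.
Proof. by rewrite /upd eqxx. Qed.

Lemma upd_neq i j a x : i != j -> upd j a x i = x i.
Proof. by rewrite /upd => /negPf ->. Qed.

Lemma step_upd_eq j a x : step j (upd j a x) = upd j a.+1 x.
Proof.
by apply/funext => l; rewrite /step /upd; case: eqP => _; rewrite ?addn1 ?addn0.
Qed.

Lemma step_upd_neq i j a x : i != j -> step i (upd j a x) = upd j a (step i x).
Proof.
move=> ij; apply/funext => l; rewrite /step /upd; case: (l =P j) => // ->.
by rewrite eq_sym (negPf ij) addn0.
Qed.

Lemma F2_addrr (a : 'F_2) : a + a = 0.
Proof. by apply: addrr_pchar2; apply: pchar_Fp. Qed.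

(* The value at the cube with least vertex [x] and edge directions [J] of the cup
   product, mod 2, of the coboundaries of the functions [bs] (for #|J| = size bs). *)
Fixpoint cup (bs : seq ((I -> nat) -> 'F_2)) (J : {set I}) x : 'F_2 :=
  if bs is b :: bs' then
    \sum_(j in J) (b (step j x) + b x) * cup bs' (J :\ j) (step j x)
  else 1.

(** Over [F_2] the terms for [(j, l)] and [(l, j)] cancel. *)
Lemma sum_sym_F2 J (g : I -> I -> 'F_2) : (forall i j, g i j = g j i) ->
  \sum_(j in J) \sum_(l in J :\ j) g j l = 0.
Proof.
move=> gC.
pose lt j l := (enum_rank j < enum_rank l)%N.
have -> : \sum_(j in J) \sum_(l in J :\ j) g j l =
    \sum_(j in J) \sum_(l in J | lt j l) g j l +
    \sum_(j in J) \sum_(l in J | lt l j) g j l.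
  rewrite -big_split /=; apply: eq_bigr => j jJ.
  rewrite (bigID (lt j)) /=; congr (_ + _); apply: eq_bigl => l;
    rewrite !inE andbC /lt; case: (l \in J); rewrite ?andbF ?andbT //=.
    by case: eqP => [->|]; rewrite ?ltnn ?andbT ?andbF.
  rewrite -leqNgt ltn_neqAle andbC; congr (_ && _).
  by rewrite (inj_eq val_inj) (inj_eq enum_rank_inj).
rewrite [X in _ + X](exchange_big_dep (mem J)) /=; last by move=> i j _ /andP[].
rewrite -[X in _ + X]/(\sum_(j in J) \sum_(i in J | (j \in J) && lt j i) g i j).
rewrite -big_split /= big1 // => j jJ.
rewrite jJ /= -big_split /= big1 // => l _.
by rewrite gC F2_addrr.
Qed.

(* By the Leibniz rule [D_j (u v) = D_j u * S_j v + u * D_j v], the coboundary of a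
   product consists of second differences of [b], symmetric in the two directions,
   and of terms containing the coboundary of a shorter product. *)
Lemma cup_closed bs J x :
  \sum_(j in J) (cup bs (J :\ j) (step j x) + cup bs (J :\ j) x) = 0.
Proof.
elim: bs J x => [|b bs IH] J x /=; first by rewrite big1 // => j _; rewrite F2_addrr.
pose w j l y := cup bs (J :\ j :\ l) y.
have wC j l y : w j l y = w l j y.
  by rewrite /w; congr (cup _ _); apply/setP => i; rewrite !inE andbCA.
pose T1 j l := (b (step l (step j x)) + b (step j x) + (b (step l x) + b x)) *
  w j l (step l (step j x)).
pose T2 j l := (b (step l x) + b x) *
  (w j l (step j (step l x)) + w j l (step l x)).
transitivity (\sum_(j in J) \sum_(l in J :\ j) T1 j l +
              \sum_(j in J) \sum_(l in J :\ j) T2 j l).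
  rewrite -big_split /=; apply: eq_bigr => j jJ.
  rewrite -!big_split /=; apply: eq_bigr => l lJ.
  rewrite /T1 /T2 -!/(w j l _) (stepC j l).
  set A := w j l _; set B := w j l _; set r := b (step l x) + b x.
  by have e : r * A + r * A = 0 := F2_addrr _; ring: e.
rewrite sum_sym_F2; last first.
  by move=> j l; rewrite /T1 wC (stepC j l); congr (_ * _); ring.
rewrite add0r.
have -> : \sum_(j in J) \sum_(l in J :\ j) T2 j l =
          \sum_(l in J) \sum_(j in J :\ l) T2 j l.
  rewrite (exchange_big_dep (mem J)) /=; last by move=> i j _ /setD1P[].
  apply: eq_bigr => l lJ; apply: eq_bigl => j.
  by rewrite !inE lJ andbT eq_sym andbC.
rewrite big1 // => l lJ; rewrite /T2 -mulr_sumr.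
rewrite (eq_bigr (fun j => cup bs (J :\ l :\ j) (step j (step l x)) +
   cup bs (J :\ l :\ j) (step l x))); first by rewrite IH mulr0.
by move=> j _; rewrite !(wC j l).
Qed.

(** The cube lies in a hyperplane on which [b] is constant, so the coboundary of [b], a factor of
    every term, vanishes on its edges. *)
Lemma cup_eq0 (bs : seq ((I -> nat) -> 'F_2)) J x b j e : b \in bs -> j \notin J ->
  (forall y, y j = x j -> b y = e) -> cup bs J x = 0.
Proof.
elim: bs J x => // b' bs IH J x; rewrite inE => bb jJ bE /=.
rewrite big1 // => l lJ.
have jl : j != l by apply: contraNneq jJ => ->.
case/orP: bb => [/eqP <-|bbs].
  by rewrite !bE ?step_neq // F2_addrr mul0r.
rewrite IH ?mulr0 //; first by rewrite !inE (negPf jJ) andbF.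
by move=> y yj; apply: bE; rewrite yj step_neq.
Qed.

(** Some term of the product is non-zero; it follows a monotone edge path from [x], and [b] changes
    along one of its edges. *)
Lemma cup_neq0 (bs : seq ((I -> nat) -> 'F_2)) J x b : cup bs J x != 0 -> b \in bs ->
  exists u v, [/\ forall i, (x i <= u i <= x i + (i \in J))%N,
    forall i, (x i <= v i <= x i + (i \in J))%N & b u != b v].
Proof.
elim: bs J x => // b' bs IH J x /= S0; rewrite inE => bb.
have /existsP[j /andP[jJ]] :
    [exists j, (j \in J) && ((b' (step j x) + b' x) * cup bs (J :\ j) (step j x) != 0)].
  apply: contraNT S0 => /existsPn S0; rewrite big1 // => j jJ.
  by have := S0 j; rewrite jJ /= negbK => /eqP.
rewrite mulf_eq0 negb_or => /andP[Db C0].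
case/orP: bb => [/eqP bE|/(IH _ _ C0)[u [v [uP vP uv]]]].
  exists (step j x), x; split; rewrite ?bE.
  - move=> i; rewrite /step leq_addr leq_add2l /=.
    by case: eqP => // ->; rewrite jJ.
  - by move=> i; rewrite leqnn leq_addr.
  - by apply: contraNneq Db => ->; rewrite F2_addrr.
have aux (w : I -> nat) : (forall i, (step j x i <= w i <= step j x i + (i \in J :\ j))%N) ->
    forall i, (x i <= w i <= x i + (i \in J))%N.
  move=> wP i; have := wP i; rewrite /step !inE.
  case: eqP => [->|_] /=; rewrite ?jJ ?addn0 ?addn1; last by [].
  by case/andP => w1 w2; rewrite w2 (ltnW w1).
by exists u, v; split => //; exact: aux.
Qed.

Variable k : nat.

(** A sum over the unit cubes, given by their least vertices, of the cube of side [k] in the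
    directions [js]; the other coordinates are those of [y]. *)
Fixpoint gsum (js : seq I) (F : (I -> nat) -> 'F_2) y : 'F_2 :=
  if js is j :: js' then \sum_(a < k) gsum js' F (upd j a y) else F y.

Lemma gsumD js F G y : gsum js (fun x => F x + G x) y = gsum js F y + gsum js G y.
Proof.
elim: js y => // j js IH y /=; rewrite -big_split /=.
by apply: eq_bigr => a _; rewrite IH.
Qed.

Lemma gsum_sum js J (F : I -> (I -> nat) -> 'F_2) y :
  gsum js (fun x => \sum_(j in J) F j x) y = \sum_(j in J) gsum js (F j) y.
Proof.
elim: js y => // j js IH y /=; rewrite exchange_big /=.
by apply: eq_bigr => a _; rewrite IH.
Qed.

Lemma eq_gsum js j F G y : j \notin js -> (forall x, x j = y j -> F x = G x) ->
  gsum js F y = gsum js G y.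
Proof.
elim: js y => [|i js IH] y /=; first by move=> _; apply.
rewrite inE negb_or => /andP[ji jjs] FG; apply: eq_bigr => a _.
by apply: IH => // x; rewrite upd_neq //; exact: FG.
Qed.

Lemma gsum0 js y : gsum js (fun=> 0) y = 0.
Proof. by elim: js y => //= j js IH y; rewrite big1. Qed.

Lemma gsum_step js j F y : j \notin js ->
  gsum js (fun x => F (step j x)) y = gsum js F (step j y).
Proof.
elim: js y => // i js IH y; rewrite inE negb_or => /andP[ji jjs] /=.
by apply: eq_bigr => a _; rewrite IH // step_upd_neq.
Qed.

Lemma telescope_F2 (h : nat -> 'F_2) : \sum_(a < k) (h a.+1 + h a) = h k + h 0%N.
Proof.
elim: k => [|n IH]; first by rewrite big_ord0 F2_addrr.
by rewrite big_ord_recr /= IH; have e : h n + h n = 0 := F2_addrr _; ring: e.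
Qed.

Lemma gsum_diff_head j js F y : j \notin js ->
  gsum (j :: js) (fun x => F (step j x) + F x) y =
  gsum js F (upd j k y) + gsum js F (upd j 0 y).
Proof.
move=> jjs /=; rewrite -(telescope_F2 (fun a => gsum js F (upd j a y))).
by apply: eq_bigr => a _; rewrite gsumD gsum_step // step_upd_eq.
Qed.

(** Summation in direction [j] telescopes to the two faces where [F] vanishes. *)
Lemma gsum_diff_eq0 j js F y : uniq js -> j \in js ->
  (forall x, x j = 0%N \/ x j = k -> F x = 0) ->
  gsum js (fun x => F (step j x) + F x) y = 0.
Proof.
elim: js y => // i js IH y /andP[ijs ujs]; rewrite inE => jjs F0.
have [ij|ij] := eqVneq j i.
  rewrite ij gsum_diff_head // -ij.
  rewrite !(@eq_gsum _ j F (fun=> 0)) ?gsum0 ?addr0 // ?ij // -ij => x.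
  - by rewrite upd_eq => xj; apply: F0; left.
  - by rewrite upd_eq => xj; apply: F0; right.
rewrite (negPf ij) /= in jjs.
by rewrite /= big1 // => a _; exact: IH.
Qed.

Lemma gsum_neq0 js F y : gsum js F y != 0 ->
  exists x, [/\ forall j, j \in js -> (x j < k)%N,
    forall j, j \notin js -> x j = y j & F x != 0].
Proof.
elim: js y => [|j js IH] y /=; first by exists y.
move=> S0; have /existsP[a /IH[x [x1 x2 Fx]]] :
    [exists a : 'I_k, gsum js F (upd j a y) != 0].
  apply: contraNT S0 => /existsPn S0; rewrite big1 // => a _.
  by have := S0 a; rewrite negbK => /eqP.
exists x; split => // l; rewrite inE.
  have [ljs _|ljs] := boolP (l \in js); first exact: x1.
  by rewrite orbF => /eqP lj; move: ljs; rewrite lj => /x2 ->; rewrite upd_eq.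
by rewrite negb_or => /andP[lj ljs]; rewrite x2 // upd_neq.
Qed.

(* As the product is closed, it is the coboundary of [b j1 * cup (map b js)]: the sum
   telescopes to the faces of the cube, of which only [x j1 = k] contributes. *)
Lemma gsum_cup js (b : I -> (I -> nat) -> 'F_2) y : uniq js ->
  (forall j x, x j = 0%N -> b j x = 0) -> (forall j x, x j = k -> b j x = 1) ->
  gsum js (cup [seq b j | j <- js] [set j in js]) y = 1.
Proof.
move=> + b0 b1; elim: js y => // j1 js IH y /andP[j1js ujs].
set J := [set j in j1 :: js].
pose w j := cup (map b js) (J :\ j).
have -> : cup [seq b j | j <- j1 :: js] J =
  fun x => \sum_(j in J) (b j1 (step j x) * w j (step j x) + b j1 x * w j x).
  apply/funext => x /=.
  rewrite -[LHS]addr0 -[X in _ + X](mulr0 (b j1 x)).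
  rewrite -[X in _ * X](cup_closed (map b js) J x) mulr_sumr -big_split /=.
  apply: eq_bigr => j _; rewrite /w.
  by set A := cup _ _ _; have e : b j1 x * A + b j1 x * A = 0 := F2_addrr _; ring: e.
rewrite gsum_sum; set g := gsum (j1 :: js).
rewrite (bigD1 j1) /=; last by rewrite !inE eqxx.
rewrite [X in _ + X]big1 => [|j /andP[+ jj1]]; last first.
  rewrite !inE (negPf jj1) /= => jjs.
  apply: (@gsum_diff_eq0 j _ (fun x => b j1 x * w j x)) => //=.
  - by rewrite j1js.
  - by rewrite inE jjs orbT.
  (* The cube with directions [J :\ j] lies in one of the two faces, where [b j] is constant. *)
  move=> x xj; rewrite /w.
  case: xj => xj; [rewrite (@cup_eq0 _ _ _ (b j) j 0)|rewrite (@cup_eq0 _ _ _ (b j) j 1)];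
    rewrite ?mulr0 ?map_f ?inE ?eqxx // => z; rewrite xj; [exact: b0|exact: b1].
have wE : w j1 = cup (map b js) [set j in js].
  rewrite /w; congr (cup _ _); apply/setP => l; rewrite !inE.
  by case: eqP => //= ->; rewrite (negPf j1js).
rewrite addr0 /g (@gsum_diff_head _ _ (fun x => b j1 x * w j1 x)) //.
rewrite (@eq_gsum _ j1 _ (w j1)) // => [|x]; last first.
  by rewrite upd_eq => xk; rewrite b1 ?mul1r.
rewrite [X in _ + X](@eq_gsum _ j1 _ (fun=> 0)) // => [|x]; last first.
  by rewrite upd_eq => xk; rewrite b0 ?mul0r.
by rewrite gsum0 addr0 wE IH.
Qed.

(** The top-degree products sum to 1, so one of them is non-zero, and every [b i] changes on its
    unit cube. *)
Lemma discrete_Poincare_Miranda (b : I -> (I -> nat) -> bool) :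
  (forall i x, x i = 0%N -> ~~ b i x) -> (forall i x, x i = k -> b i x) ->
  exists x, (forall i, (x i < k)%N) /\
    forall i, exists u v, [/\ forall l, (x l <= u l <= (x l).+1)%N,
      forall l, (x l <= v l <= (x l).+1)%N & b i u != b i v].
Proof.
move=> b0 b1; pose c i x : 'F_2 := (b i x)%:R.
have : gsum (enum I) (cup [seq c j | j <- enum I] [set j in enum I]) (fun=> 0%N) != 0.
  rewrite gsum_cup ?oner_eq0 ?enum_uniq //.
  - by move=> i x xi; rewrite /c (negPf (b0 _ _ xi)).
  - by move=> i x xi; rewrite /c b1.
case/gsum_neq0 => x [xk _ /cup_neq0 cx].
exists x; split=> [i|i]; first by apply: xk; rewrite mem_enum.
have /cx[u [v [uP vP uv]]] : c i \in [seq c j | j <- enum I].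
  by rewrite map_f // mem_enum.
exists u, v; split=> [l|l|].
- by have := uP l; rewrite !inE mem_enum addn1.
- by have := vP l; rewrite !inE mem_enum addn1.
- by apply: contraNneq uv; rewrite /c => ->.
Qed.

End CupProducts.

(** * The Lebesgue covering theorem on a grid *)

(** If no cell joined opposite faces, the functions [b i] of the proof would satisfy the boundary
    conditions of [discrete_Poincare_Miranda]; but on each unit cube [q] the one of index [c q] is
    constant. Grid points become cubes, hence the side [k.+1]. *)
Lemma discrete_Lebesgue (I : finType) (T : Type) (k : nat)
    (c : (I -> nat) -> I) (cell : (I -> nat) -> T) :
  (forall x y, (forall i, (x i <= k)%N) -> (forall i, (y i <= k)%N) ->
    (forall i, (x i <= (y i).+1)%N && (y i <= (x i).+1)%N) ->
    c x = c y -> cell x = cell y) ->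
  exists i x y, (forall l, (x l <= k)%N) /\ (forall l, (y l <= k)%N) /\
    [/\ c x = i, c y = i, cell x = cell y, x i = 0%N & y i = k].
Proof.
move=> cellP; apply: contrapT => noi.
pose grid (x : I -> nat) := forall l, (x l <= k)%N.
pose near (q v : I -> nat) := forall l, (q l <= v l <= (q l).+1)%N.
pose high i q := exists y, [/\ grid y, c y = i, cell y = cell q & y i = k].
(* [q] is a unit cube of the lattice {0..k+1}^I; its colour and cell are those of its
   least vertex.  All vertices of [q] get the same bit [b (c q)]. *)
pose b i v := `[< v i = k.+1 \/ exists q, [/\ near q v, grid q, c q = i & high i q] >].
have b0 i x : x i = 0%N -> ~~ b i x.
  move=> xi; apply/asboolPn => -[|[q [qx gq cq [y [gy cy yq yk]]]]]; first by rewrite xi.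
  apply: noi; exists i, q, y; do 2!split => //; split => //.
  by have := qx i; rewrite xi leqn0 andbC => /andP[_ /eqP].
have b1 i x : x i = k.+1 -> b i x by move=> xi; apply/asboolP; left.
have [q [qk /(_ (c q))[u [v [qu qv]]]]] := discrete_Poincare_Miranda b0 b1.
have gq : grid q by move=> l; rewrite -ltnS.
suff bq w : near q w -> b (c q) w = `[< high (c q) q >] by rewrite !bq ?eqxx.
move=> qw; apply/asboolP/asboolP => [[wk|[q' [q'w gq' cq' [y [gy cy yq' yk]]]]]|hq]; last first.
- by right; exists q.
(* Cubes sharing the vertex [w] have neighbouring least vertices, so equal colours force equal
   cells. *)
- exists y; split=> //; rewrite yq'; apply: cellP => // l.
  by have := qw l; have := q'w l; lia.
(* A vertex on the top face forces [q (c q) = k], so [q] itself is the witness. *)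
- exists q; split=> //; have := qw (c q); have := qk (c q); lia.
Qed.

(** * Distance to the nearest integer, and maps avoiding the integer lattice *)

Section DistanceToIntegers.
Variable R : realType.
Implicit Types r s e : R.

Definition nearest r : int := Num.floor (r + 2^-1).

Definition distZ r : R := `|r - (nearest r)%:~R|.

Lemma floor_bounds r : (Num.floor r)%:~R <= r < (Num.floor r)%:~R + 1.
Proof. by have := floor_itv r; rewrite intrD. Qed.

Lemma distZ_half r : distZ r <= 2^-1.
Proof.
rewrite /distZ /nearest ler_norml; have := floor_bounds (r + 2^-1); lra.
Qed.

(** Any integer other than the nearest one is at least 1/2 away. *)
Lemma distZ_le r (z : int) : distZ r <= `|r - z%:~R|.
Proof.
have [->//|zr] := eqVneq z (nearest r).
apply: le_trans (distZ_half r) _.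
have := floor_bounds (r + 2^-1); rewrite -/(nearest r).
have [zr1|zr1] : (z + 1 <= nearest r \/ nearest r + 1 <= z) by lia.
  have := zr1; rewrite -(ler_int R) intrD => zr2 ?; rewrite ler_normr; apply/orP; left; lra.
have := zr1; rewrite -(ler_int R) intrD => zr2 ?; rewrite ler_normr; apply/orP; right; lra.
Qed.

Lemma distZ_lipschitz r s : distZ r <= `|r - s| + distZ s.
Proof.
apply: le_trans (distZ_le r (nearest s)) _.
by have := ler_normD (r - s) (s - (nearest s)%:~R); rewrite addrA subrK.
Qed.

Lemma nearest_eq r s e e' : distZ r < e -> distZ s < e -> `|r - s| < e' ->
  e *+ 2 + e' <= 1 -> nearest r = nearest s.
Proof.
rewrite /distZ !ltr_norml => re se rs ee.
apply/eqP; rewrite eq_le -!ltzD1 -!(ltr_int R) !intrD; apply/andP; split; lra.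
Qed.

(** Different floors would put an integer between [r] and [s], closer than [e] to the smaller
    one. *)
Lemma floor_eq_close r s e : e <= distZ r -> e <= distZ s -> `|r - s| < e ->
  Num.floor r = Num.floor s.
Proof.
suff aux r' s' : e <= distZ r' -> `|r' - s'| < e -> ~ Num.floor r' < Num.floor s'.
  move=> er es rs; have := aux _ _ er rs.
  by rewrite distrC in rs; have := aux _ _ es rs; lia.
move=> er rs; rewrite -lezD1 -(ler_int R) intrD.
have /andP[_ r1] := floor_bounds r'; have /andP[s1 _] := floor_bounds s'.
move=> r2; have := distZ_le r' (Num.floor s').
rewrite ler0_norm; last by lra.
by move: rs; rewrite ltr_norml; lra.
Qed.

End DistanceToIntegers.

(** Used by contradiction: for a map avoiding the lattice by [d], the two points found violate the
    separation of opposite faces. Ranking [I] by [enum_rank] lets the coordinates serve as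
    colours. *)
Lemma grid_map_meets_lattice (R : realType) (I : finType) (k : nat)
    (g : (I -> nat) -> I -> R) (d : R) : 0 < d -> d <= 2^-1 ->
  (forall x, (forall i, (x i <= k)%N) -> exists i, d <= distZ (g x i)) ->
  (forall x y, (forall i, (x i <= k)%N) -> (forall i, (y i <= k)%N) ->
    (forall i, (x i <= (y i).+1)%N && (y i <= (x i).+1)%N) ->
    forall i, `|g x i - g y i| < d / #|I|%:R) ->
  exists i x y, (forall l, (x l <= k)%N) /\ (forall l, (y l <= k)%N) /\
    [/\ x i = 0%N, y i = k & forall j, `|g x j - g y j| < 1].
Proof.
move=> d0 d2 gd gc.
have [i0 _] := gd (fun=> 0%N) (fun=> isT).
have N0 : 0 < #|I|%:R :> R by rewrite ltr0n; apply/card_gt0P; exists i0.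
set N : R := #|I|%:R in gc N0 *.
pose th (r : nat) : R := d * r%:R / N.
have thS r : th r.+1 = th r + d / N by rewrite /th -natr1 mulrDr mulr1 mulrDl.
have dN : 0 < d / N by rewrite divr_gt0.
have th_lt (l : I) : th (enum_rank l) + d / N <= d.
  rewrite -thS /th -mulrA ger_pMr // ler_pdivrMr // mul1r /N ler_nat.
  exact: ltn_ord.
have th_ge0 r : 0 <= th r by rewrite /th divr_ge0 ?mulr_ge0 // ltW.
pose gap (x : I -> nat) (l : I) := forall i,
  ~ (th (enum_rank l) <= distZ (g x i) < th (enum_rank l) + d / N).
pose c x := xget i0 [set l | gap x l].
have cP x : (forall i, (x i <= k)%N) -> gap x (c x).
  move=> gx; apply: (@xgetPex _ i0 [set l | gap x l]).
  apply: contrapT => /forallNP nogap.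
  have {}nogap (l : I) : exists i, th (enum_rank l) <= distZ (g x i) < th (enum_rank l) + d / N.
    by have /existsNP[i /contrapT ?] : ~ gap x l := nogap l; exists i.
  have [h hP] := choice nogap.
  (* The intervals are disjoint, so distinct colours choose distinct coordinates; then [h] is onto,
     and every coordinate would be closer than [d] to an integer. *)
  have hI : injective h.
    move=> l l' hl; apply: enum_rank_inj; apply: val_inj.
    have := hP l; have := hP l'; rewrite hl => /andP[a1 a2] /andP[b1 b2] /=.
    have mono (r s : nat) : th r < th s + d / N -> (r <= s)%N.
      rewrite -thS /th ltr_pdivrMr // divfK ?gt_eqF // ltr_pM2l // ltr_nat.
      by rewrite ltnS.
    apply/eqP; rewrite eqn_leq; apply/andP.
    by split; apply: mono; [exact: le_lt_trans b1 a2|exact: le_lt_trans a1 b2].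
  have [i di] := gd x gx.
  have [h' _ hK] := injF_bij hI.
  have := hP (h' i); rewrite hK => /andP[_].
  by apply/negP; rewrite -leNgt (le_trans (th_lt _)).
pose cell x := (fun i => distZ (g x i) < th (enum_rank (c x)),
  fun i => if distZ (g x i) < th (enum_rank (c x))
           then nearest (g x i) else Num.floor (g x i)).
have [x y gx gy xy cxy|i [x [y [gx [gy [cx cy [cell1 cell2] xi yi]]]]]] :=
    @discrete_Lebesgue I _ k c cell.
  have close i := gc x y gx gy xy i.
  have far z i : (forall i, (z i <= k)%N) -> ~~ (distZ (g z i) < th (enum_rank (c z))) ->
      th (enum_rank (c z)) + d / N <= distZ (g z i).
    move=> gz; rewrite -leNgt => zi; rewrite leNgt; apply/negP => zi'.
    by apply: (cP z gz i); rewrite zi.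
  (* Between neighbours a distance changes by less than [d / N], the width of the gap, so it cannot
     jump across. *)
  have same i : (distZ (g x i) < th (enum_rank (c x))) =
                (distZ (g y i) < th (enum_rank (c y))).
    apply/idP/idP => [h|h]; apply: contraTT h => /far h; rewrite -leNgt.
      have := h gy; rewrite -cxy; have := distZ_lipschitz (g y i) (g x i).
      by rewrite distrC; have := close i; lra.
    have := h gx; rewrite cxy; have := distZ_lipschitz (g x i) (g y i).
    by have := close i; lra.
  congr pair; apply/funext => i; rewrite same //.
  case: ifP => hy.
    apply: (@nearest_eq _ _ _ (th (enum_rank (c y))) (d / N)) => //.
      by rewrite -cxy same.
    have := th_lt (c y); have := ltW dN; lra.
  have hx : ~~ (distZ (g x i) < th (enum_rank (c x))) by rewrite same hy.
  have := far _ _ gx hx; have := far _ _ gy (negbT hy) => fy fx.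
  apply: (@floor_eq_close _ _ _ (d / N)) => //.
    by apply: le_trans fx; rewrite lerDr.
  by apply: le_trans fy; rewrite lerDr.
(* Coordinates below the threshold, itself less than 1/2, are near the same integer; the others have
   the same floor. *)
exists i, x, y; do 2!split => //; split=> // j.
have := congr1 (@^~ j) cell1; have := congr1 (@^~ j) cell2; rewrite /= cx cy.
have := th_lt i.
case: ifP => hx; last first.
  move=> _ + /esym hy; rewrite hy => fE.
  have := floor_bounds (g x j); have := floor_bounds (g y j); rewrite fE.
  by rewrite ltr_norml; lra.
move=> thi + /esym hy; rewrite hy => nE.
move: hx hy; rewrite /distZ nE !ltr_norml; lra.
Qed.

(** * Injective images of cubes *)

(** Near-covering compactness along the filter of positive numbers tending to 0; local bounds
    combine because [P] holds for all smaller [e] too. *)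
Lemma compact_uniform (R : realType) (T : topologicalType) (K : set T)
    (P : R -> T -> Prop) : compact K ->
  (forall x, K x -> exists2 e0, 0 < e0 &
    \forall x' \near x, forall e, 0 < e <= e0 -> P e x') ->
  exists2 e, 0 < e & forall x, K x -> P e x.
Proof.
move=> /compact_near_coveringP cK KP.
have : \forall e \near (0 : R)^'+, K `<=` P e.
  apply: cK => x /KP[e0 e00 Px].
  exists ([set x' | forall e, 0 < e <= e0 -> P e x'], [set e | 0 < e <= e0]).
    split => //=; apply: filterS2 (nbhs_right_gt _) (nbhs_right_le e00) => e e1 e2 /=.
    by rewrite e1.
  by move=> [x' e] [/= + e1]; apply.
move=> /(filterI (nbhs_right_gt 0))/filter_ex[e [e1 e2]].
by exists e => // x /e2.
Qed.

Section UnitCube.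
Variables (R : realType) (m n : nat).
Implicit Types (X Y : 'M[R]_(m, n)) (h : 'M[R]_(m, n) -> 'M[R]_(m, n)).

Definition unit_cube : set 'M[R]_(m, n) := [set X | forall i j, 0 <= X i j <= 1].

Lemma vec_mx_continuous : continuous (vec_mx : 'rV[R]_(m * n) -> 'M[R]_(m, n)).
Proof.
move=> u A /nbhs_ballP[e e0 eA]; apply/nbhs_ballP; exists e => // v [_ uv].
by apply: eA; split => // i j; rewrite !mxE.
Qed.

Lemma compact_unit_cube : compact unit_cube.
Proof.
have -> : unit_cube = vec_mx @`
    [set v : 'rV[R]_(m * n) | forall i, `[0, 1]%classic (v ord0 i)].
  apply/seteqP; split => [X X01|_ [v v01 <-] i j].
    exists (mxvec X); last exact: mxvecK.
    move=> i /=; rewrite in_itv /=.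
    by case/mxvec_indexP: i => i j; rewrite mxvecE.
  by have := v01 (mxvec_index i j); rewrite /= in_itv /= mxE.
apply: continuous_compact; first exact/continuous_subspaceT/vec_mx_continuous.
apply: (@rV_compact R (m * n)%N (fun=> `[0, 1]%classic)) => _.
exact: segment_compact.
Qed.

Lemma ler_mx_entry X i j : `|X i j| <= `|X|.
Proof. by rewrite [leRHS]/Num.norm /= mx_normrE; exact: (le_bigmax _ _ (i, j)). Qed.

Lemma mx_norm_lt X e : 0 < e -> (forall i j, `|X i j| < e) -> `|X| < e.
Proof.
move=> e0 Xe; rewrite [ltLHS]/Num.norm /= mx_normrE.
by apply/bigmax_ltP; split=> // -[i j] _; exact: Xe.
Qed.

(** Compactness of the set of pairs: near the diagonal the premise on [X - Y] fails, and near any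
    other pair the norm of [h X - h Y] stays above half its value there. *)
Lemma cube_faces_separated h :
  (forall X, unit_cube X -> {for X, continuous h}) ->
  {in unit_cube &, injective h} ->
  exists2 e, 0 < e & forall X Y, unit_cube X -> unit_cube Y ->
    1 <= `|X - Y| -> e <= `|h X - h Y|.
Proof.
move=> hC hI.
pose P e (XY : 'M[R]_(m, n) * 'M[R]_(m, n)) :=
  1 <= `|XY.1 - XY.2| -> e <= `|h XY.1 - h XY.2|.
have [|e e0 eP] := @compact_uniform R _ (unit_cube `*` unit_cube) P
    (compact_setX compact_unit_cube compact_unit_cube); last first.
  by exists e => // X Y CX CY; exact: (eP (X, Y)).
move=> [X Y] [/= CX CY].
have cfst : (fun XY : 'M[R]_(m, n) * 'M[R]_(m, n) => XY.1) @ (X, Y) --> X by exact: cvg_fst.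
have csnd : (fun XY : 'M[R]_(m, n) * 'M[R]_(m, n) => XY.2) @ (X, Y) --> Y by exact: cvg_snd.
have [XY|XY] := eqVneq X Y.
  exists 1 => //.
  have : `|XY.1 - XY.2| @[XY --> (X, Y)] --> `|X - Y| by exact: cvg_norm (cvgB cfst csnd).
  move=> /cvgr_lt/(_ 1); rewrite {1}XY subrr normr0 => /(_ ltr01).
  by apply: filterS => -[X' Y'] /= lt1 e _; rewrite /P /= leNgt lt1.
have d0 : 0 < `|h X - h Y|.
  by rewrite normr_gt0 subr_eq0; apply: contraNneq XY => /hI ->; rewrite ?inE.
exists (`|h X - h Y| / 2); first by rewrite divr_gt0.
have : `|h XY.1 - h XY.2| @[XY --> (X, Y)] --> `|h X - h Y|.
  apply: cvg_norm; apply: cvgB.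
    exact: (cvg_comp _ _ cfst (hC _ CX)).
  exact: (cvg_comp _ _ csnd (hC _ CY)).
move=> /cvgr_gt/(_ (`|h X - h Y| / 2)) /(_ _); rewrite ltr_pdivrMr // mulr2n mulrDr mulr1 ltrDl.
move=> /(_ d0); apply: filterS => XY' lt e /andP[_ le] _.
exact: le_trans le (ltW lt).
Qed.

Lemma unit_cube_unif_continuous h e : 0 < e ->
  (forall X, unit_cube X -> {for X, continuous h}) ->
  exists2 d, 0 < d & forall X Y, unit_cube X -> `|X - Y| < d -> `|h X - h Y| < e.
Proof.
move=> e0 hC.
have [|d d0 dP] := @compact_uniform R _ unit_cube
    (fun d X => forall Y, `|X - Y| < d -> `|h X - h Y| < e) compact_unit_cube; last first.
  by exists d => // X Y /dP; exact.
move=> X CX.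
have /cvgr_distC_lt/(_ (e / 2)) := hC X CX.
rewrite divr_gt0 // => /(_ isT)/nbhs_normP[r r0 rP].
have r0' : 0 < r by [].
exists (r / 2); first by rewrite divr_gt0.
apply/nbhs_normP; exists (r / 2) => [|X' XX' d /andP[_ dr] Y X'Y]; first by rewrite /= divr_gt0.
have h1 : `|h X' - h X| < e / 2.
  by apply: rP; rewrite /ball_ /= in XX' *; lra.
have h2 : `|h Y - h X| < e / 2.
  apply: rP; rewrite /ball_ /= in XX' *; have := ler_distD X' X Y; lra.
by have := ler_distD (h X) (h X') (h Y); rewrite (distrC (h X) (h Y)); lra.
Qed.

Lemma unit_cube_image_meets_lattice h :
  (forall X, unit_cube X -> {for X, continuous h}) ->
  {in unit_cube &, injective h} ->
  exists s0 : R, forall (s : R) (C : 'M[R]_(m, n)), s0 <= s -> exists X (Z : 'M[int]_(m, n)),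
    unit_cube X /\ forall i j, h X i j = C i j + (Z i j)%:~R / s.
Proof.
move=> hC hI; have [eta eta0 hE] := cube_faces_separated hC hI.
(* For such [s] the rescaled map [g] below is integral exactly where [h] hits the translated
   lattice, and it keeps opposite faces at least 1 apart. *)
exists eta^-1 => s C s_ge; apply: contrapT => avoid.
have s0 : 0 < s by apply: lt_le_trans s_ge; rewrite invr_gt0.
pose g X i j := s * (h X i j - C i j).
have gdist X Y i j : `|g X i j - g Y i j| = s * `|(h X - h Y) i j|.
  rewrite /g -mulrBr normrM gtr0_norm // !mxE; congr (_ * `|_|); ring.
have avoid_at X : unit_cube X -> exists ij, 0 < distZ (g X ij.1 ij.2).
  move=> CX; apply: contrapT => /forallNP dX; apply: avoid.
  exists X, (\matrix_(i, j) nearest (g X i j)); split=> // i j; rewrite mxE.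
  have := dX (i, j); rewrite /distZ normr_gt0 subr_eq0 => /negP; rewrite negbK => /eqP <-.
  by rewrite /g mulrC mulKf ?gt_eqF // addrC subrK.
have [|d d0 dP] := @compact_uniform R _ unit_cube
    (fun d X => exists ij, d <= distZ (g X ij.1 ij.2)) compact_unit_cube.
  move=> X CX; have [[i j] /= dX] := avoid_at X CX; set t := distZ _ in dX.
  exists (t / 2); first by rewrite divr_gt0.
  have /cvgr_dist_lt/(_ (t / 2 / s)) := hC X CX.
  rewrite !divr_gt0 // => /(_ isT).
  apply: filterS => X' hXX' d /andP[d0 dt]; exists (i, j) => /=.
  have := distZ_lipschitz (g X i j) (g X' i j); rewrite -/t gdist.
  have : s * `|(h X - h X') i j| < t / 2.
    by rewrite mulrC -ltr_pdivlMr //; exact: le_lt_trans (ler_mx_entry _ _ _) hXX'.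
  lra.
pose d' := Num.min d 2^-1.
have d'0 : 0 < d' by rewrite lt_min d0 /= invr_gt0.
have d'd : d' <= d by rewrite ge_min lexx.
(* Avoidance at the zero matrix supplies an index, so [N] is positive. *)
have [[i0 j0] _] : exists ij, 0 < distZ (g 0 ij.1 ij.2).
  by apply: avoid_at => i j; rewrite mxE lexx ler01.
set N : R := #|{: 'I_m * 'I_n}|%:R.
have N0 : 0 < N by rewrite ltr0n; apply/card_gt0P; exists (i0, j0).
have [|r r0 rP] := @unit_cube_unif_continuous h (d' / N / s) _ hC.
  by rewrite !divr_gt0.
pose k := (Num.truncn r^-1).+1.
have kr : k%:R^-1 < r :> R.
  rewrite -[r]invrK ltf_pV2 ?posrE ?invr_gt0 ?ltr0n //.
  exact: truncnS_gt.
have k0 : 0 < k%:R :> R by rewrite ltr0n.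
pose pt (x : 'I_m * 'I_n -> nat) : 'M[R]_(m, n) := \matrix_(i, j) ((x (i, j))%:R / k%:R).
have ptC x : (forall ij, (x ij <= k)%N) -> unit_cube (pt x).
  by move=> xk i j; rewrite mxE divr_ge0 //= ler_pdivrMr // mul1r ler_nat.
have [|x xk|x y xk yk xy [i j] /=|[i j] [x [y [xk [yk [xi yi xy]]]]]] :=
  @grid_map_meets_lattice R _ k (fun x ij => g (pt x) ij.1 ij.2) d' d'0.
- by rewrite ge_min lexx orbT.
- have [ij dX] := dP _ (ptC x xk).
  by exists ij; exact: le_trans dX.
- rewrite gdist mulrC -ltr_pdivlMr //.
  apply: le_lt_trans (ler_mx_entry _ _ _) (rP _ _ (ptC x xk) _).
  apply: mx_norm_lt => // i' j'; apply: le_lt_trans kr; rewrite !mxE -mulrBl normrM.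
  rewrite [X in _ * X]gtr0_norm ?invr_gt0 //.
  apply: ler_piMl; first by rewrite invr_ge0 ltW.
  have /andP[] := xy (i', j'); rewrite -!(ler_nat R) -!natr1 ler_norml; lra.
(* Entries of [g] less than 1 apart mean entries of [h] less than [s^-1 <= eta] apart, although the
   points lie on opposite faces. *)
suff : `|h (pt x) - h (pt y)| < eta.
  apply/negP; rewrite -leNgt; apply: hE; [exact: ptC|exact: ptC|].
  apply: le_trans (ler_mx_entry _ i j); rewrite !mxE xi yi mul0r divff ?gt_eqF //.
  by rewrite sub0r normrN1.
apply: lt_le_trans (_ : s^-1 <= _); last by rewrite -[eta]invrK lef_pV2 ?posrE ?invr_gt0.
apply: mx_norm_lt; first by rewrite invr_gt0.
move=> i' j'; have := xy (i', j'); rewrite /= gdist.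
by rewrite -ltr_pdivlMl // mulr1.
Qed.

End UnitCube.

Lemma lipschitz_continuous (R : realType) (V W : normedModType R) (f : V -> W) (k : R) :
  (forall x y, `|f x - f y| <= k * `|x - y|) -> continuous f.
Proof.
move=> fk x; apply/cvgrPdist_lt => e e0.
have k0 : 0 < `|k| + 1 by rewrite ltr_wpDl.
apply/nbhs_normP; exists (e / (`|k| + 1)) => [|y xy]; first by rewrite /= divr_gt0.
apply: le_lt_trans (fk x y) _; apply: le_lt_trans (_ : (`|k| + 1) * `|x - y| < _).
  by rewrite ler_wpM2r // (le_trans (ler_norm k)) // lerDl.
by rewrite mulrC -ltr_pdivlMr.
Qed.

(** A copy of the unit cube scaled by [r / 2] fits in a ball of radius [r] inside [B]. *)
Lemma injective_image_meets_lattice (R : realType) (m n : nat)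
    (f : 'M[R]_(m, n) -> 'M[R]_(m, n)) (B : set 'M[R]_(m, n)) :
  open B -> B !=set0 -> {in B, continuous f} -> {in B &, injective f} ->
  exists s0 : R, forall (s : R) (C : 'M[R]_(m, n)), s0 <= s -> exists A (Z : 'M[int]_(m, n)),
    B A /\ forall i j, f A i j = C i j + (Z i j)%:~R / s.
Proof.
move=> oB [A0 BA0] fC fI.
have /nbhs_normP[r r0 rB] : nbhs A0 B by exact: open_nbhs_nbhs.
have r0' : 0 < r by [].
have r2 : 0 < r / 2 by rewrite divr_gt0.
pose e (X : 'M[R]_(m, n)) : 'M[R]_(m, n) := A0 + (r / 2) *: X.
have eB X : unit_cube X -> B (e X).
  move=> CX; apply: rB; rewrite /ball_ /= /e opprD addNKr normrN normrZ gtr0_norm //.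
  rewrite -ltr_pdivlMl // invf_div mulfVK ?gt_eqF //.
  apply: mx_norm_lt => // i j; have := CX i j.
  by rewrite ltr_norml; lra.
have eC : continuous e.
  apply: (@lipschitz_continuous _ _ _ _ (r / 2)) => X Y.
  by rewrite /e opprD addrACA subrr add0r -scalerBr normrZ gtr0_norm.
have [X CX|X Y|s0 hs0] := @unit_cube_image_meets_lattice R m n (f \o e).
- by apply: continuous_comp; [exact: eC|apply: fC; rewrite inE; exact: eB].
- rewrite !inE => CX CY /fI; rewrite !inE => /(_ (eB _ CX) (eB _ CY)).
  by move/addrI/scalerI; apply; rewrite gt_eqF.
exists s0 => s C /(hs0 s C)[X [Z [CX XZ]]].
by exists (e X), Z; split=> //; exact: eB.
Qed.

(** * Genericity of Liouville matrices *)

Lemma residual_in_open (R : realType) (M : completeNormedModType R) (T : countType)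
    (U : set M) (O : T -> set M) : open U -> (forall t, open (O t)) ->
  (forall t B, open B -> B !=set0 -> B `<=` U -> B `&` O t !=set0) ->
  Gdelta_in U (U `&` \bigcap_(t in [set: T]) O t) /\
  dense_in U (U `&` \bigcap_(t in [set: T]) O t).
Proof.
move=> oU oO dO.
(* Numbers coding no element of [T] give the whole space, which leaves the intersection
   unchanged. *)
pose P (i : nat) := if unpickle i is Some t then O t else [set: M].
have oP i : open (P i) by rewrite /P; case: unpickle => [t|]; [exact: oO|exact: openT].
have PE : \bigcap_(i in [set: nat]) P i = \bigcap_(t in [set: T]) O t.
  apply/seteqP; split=> [x Px t _|x Ox i _]; last first.
    by rewrite /P; case: unpickle => // t; exact: Ox.
  by have := Px (pickle t) I; rewrite /P pickleK.
split; first by exists P; split => //; rewrite PE.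
split=> [x []//|x Ux B /= Bx].
(* Adding the exterior of [U] gives dense open sets of the whole space, where Baire applies, and
   changes nothing inside [U]. *)
pose Q i := P i `|` ~` closure U.
have : dense (\bigcap_i Q i).
  apply: Baire => i; split.
    by apply: openU => //; exact/closed_openC/closed_closure.
  move=> V V0 oV; have [VU0|] := pselect (V `&` U !=set0).
    have [y [[Vy Uy] Oy]] : (V `&` U) `&` P i !=set0.
      rewrite /P; case: unpickle => [t|]; last by rewrite setIT.
      by apply: dO; [exact: openI|exact: VU0|exact: subIsetr].
    by exists y; split=> //; left.
  move=> VU; case: V0 => y Vy; exists y; split=> //; right => cy; apply: VU.
  by rewrite setIC; apply: cy; exact: open_nbhs_nbhs.
have [V [oV Vx] VB] : exists2 V, open_nbhs x V & V `<=` B by move: Bx; rewrite nbhsE.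
case/(_ (V `&` U)); [by exists x|exact: openI|].
move=> y [[Vy Uy] Qy]; exists y; split; last exact: VB.
split=> //; rewrite -PE => i _.
by case: (Qy i I) => // /(_ (subset_closure Uy)).
Qed.

(** Joins completeness to the normed structure, as [residual_in_open] requires. *)
HB.instance Definition _ (R : realType) (m n : nat) :=
  Uniform_isComplete.Build 'M[R]_(m, n) cauchy_cvg.

Section LiouvilleOpenSets.
Variables (R : realType) (m n : nat).
Implicit Types (A : 'M[R]_(m, n)) (q : 'cV[int]_n) (p : 'cV[int]_m).

Lemma intvec_eq0 k (v : 'cV[int]_k) : (intvec R v == 0) = (v == 0).
Proof.
apply/eqP/eqP => [v0|->]; last by apply/matrixP => i j; rewrite !mxE.
apply/matrixP => i j; have /matrixP/(_ i j)/eqP := v0.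
by rewrite !mxE intr_eq0 => /eqP.
Qed.

Lemma norm_mulmx_affine_continuous (v : 'cV[R]_n) (w : 'cV[R]_m) :
  continuous (fun A : 'M[R]_(m, n) => `|A *m v - w|).
Proof.
apply: (@lipschitz_continuous R _ R^o _ (n%:R * `|v|)) => A A'.
apply: le_trans (ler_dist_dist _ _) _; rewrite opprB addrA subrK -mulmxBl [leLHS]/Num.norm /= mx_normrE.
apply/bigmax_leP; split=> [|[i j] _ /=]; first by rewrite !mulr_ge0.
rewrite mxE; apply: le_trans (ler_norm_sum _ _ _) _.
apply: le_trans (_ : \sum_(k < n) `|A - A'| * `|v| <= _).
  by apply: ler_sum => k _; rewrite normrM ler_pM // ler_mx_entry.
by rewrite sumr_const card_ord -[leLHS]mulr_natl mulrA mulrAC.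
Qed.

(** Both clauses of the Liouville definition share one countable index type, so that a single Baire
    argument treats them. *)
Definition Liouville_cond (w : nat + 'cV[int]_n * 'cV[int]_m) : set 'M[R]_(m, n) :=
  match w with
  | inl N => [set A | exists p q, q != 0 /\
      mx_norm (A *m intvec R q - intvec R p) < (mx_norm (intvec R q)) ^- N]
  | inr (q, p) => [set A | (q != 0) || (p != 0) -> A *m intvec R q - intvec R p != 0]
  end.

Lemma Liouville_setE : @Liouville_set R m n = \bigcap_(w in [set: _]) Liouville_cond w.
Proof.
apply/seteqP; split=> [A [irr app] [N|[q p]] _|A cA] /=; first exact: app.
  by move/orP; exact: irr.
split=> [q p /orP|N]; first exact: (cA (inr (q, p))).
exact: (cA (inl N)).
Qed.

Lemma open_Liouville_cond w : open (Liouville_cond w).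
Proof.
case: w => [N|[q p]].
  have -> : Liouville_cond (inl N) = \bigcup_(p in [set: 'cV[int]_m])
      \bigcup_(q in [set q : 'cV[int]_n | q != 0])
      (fun A => `|A *m intvec R q - intvec R p|) @^-1` [set x | x < `|intvec R q| ^- N].
    apply/seteqP; split=> [A [p [q [q0 Aq]]]|A [p _ [q /= q0 Aq]]].
      by exists p => //; exists q.
    by exists p, q.
  apply: bigcup_open => p _; apply: bigcup_open => q _.
  apply: open_comp; last exact: open_lt.
  by move=> A _; exact: norm_mulmx_affine_continuous.
have [qp|qp] := boolP ((q != 0) || (p != 0)); last first.
  rewrite (_ : Liouville_cond _ = setT); first exact: openT.
  by apply/seteqP; split=> // A _ /=; rewrite (negPf qp).
rewrite (_ : Liouville_cond _ =
  (fun A => `|A *m intvec R q - intvec R p|) @^-1` [set x | x > 0]); last first.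
  by apply/seteqP; split=> A /=; rewrite qp normr_gt0; [apply|].
apply: open_comp; last exact: open_gt.
by move=> A _; exact: norm_mulmx_affine_continuous.
Qed.

Lemma Liouville_cond_meets_image (f : 'M[R]_(m, n) -> 'M[R]_(m, n))
    (B : set 'M[R]_(m, n)) w : (0 < m)%N -> (0 < n)%N ->
  open B -> B !=set0 -> {in B, continuous f} -> {in B &, injective f} ->
  B `&` f @^-1` Liouville_cond w !=set0.
Proof.
move=> m0 n0 oB B0 fC fI.
have [s0 lattice] := injective_image_meets_lattice oB B0 fC fI.
pose s := (Num.truncn s0).+1.
have {}lattice (C : 'M[R]_(m, n)) : exists A (Z : 'M[int]_(m, n)),
    B A /\ forall i j, f A i j = C i j + (Z i j)%:~R / s%:R.
  by apply: lattice; exact/ltW/truncnS_gt.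
have s_neq0 : s%:R != 0 :> R by rewrite pnatr_eq0.
case: w => [N|[q p]].
  have [A [Z [BA AZ]]] := lattice 0; exists A; split=> //=.
  pose j0 := Ordinal n0.
  (* As [f A] is [Z / s], it maps [s] times the [j0]-th basis vector exactly to column [j0] of [Z]:
     the error is 0. *)
  exists (col j0 Z), (\col_j (if j == j0 then s%:Z else 0)); set q := \col_j _.
  have q0 : q != 0.
    by apply: contraTneq isT => /matrixP/(_ j0 0); rewrite !mxE eqxx.
  split=> //.
  suff -> : f A *m intvec R q - intvec R (col j0 Z) = 0.
    rewrite mx_norm0 invr_gt0 exprn_gt0 //.
    by rewrite -[mx_norm _]/(`|intvec R q|) normr_gt0 intvec_eq0.
  apply/matrixP => i j; rewrite !mxE (bigD1 j0) //= big1 => [|k kj0]; last first.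
    by rewrite !mxE (negPf kj0) mulr0.
  by rewrite !mxE eqxx AZ mxE add0r addr0 -[s%:Z%:~R]/(s%:R) divfK // subrr.
have [q0|q0] := eqVneq q 0.
  case: B0 => A BA; exists A; split=> //= /orP[|p0]; first by rewrite q0 eqxx.
  rewrite q0 (_ : intvec R 0 = 0) ?mulmx0 ?sub0r ?oppr_eq0 ?intvec_eq0 //.
  by apply/eqP; rewrite intvec_eq0.
have [j0 qj0] : exists j, q j 0 != 0.
  apply: contrapT => /forallNP qj; move: q0; apply/negP; rewrite negbK.
  by apply/eqP/matrixP => j k; rewrite ord1 mxE; apply/eqP; apply: contrapT => /negP /qj.
pose i0 := Ordinal m0.
have qR : (q j0 0)%:~R != 0 :> R by rewrite intr_eq0.
(* The entry in column [j0] makes each coordinate of the shift times [q] equal to [1 / (2 s)], half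
   a lattice step. *)
have [A [Z [BA AZ]]] :=
  lattice (\matrix_(i, j) (if j == j0 then (2 * s%:R * (q j0 0)%:~R)^-1 else 0)).
exists A; split=> //= _; apply/eqP => /matrixP/(_ i0 0)/eqP.
rewrite !mxE subr_eq0.
have -> : \sum_j f A i0 j * intvec R q j 0 =
    (2 * s%:R)^-1 + (\sum_j Z i0 j * q j 0)%:~R / s%:R.
  under eq_bigr do rewrite AZ mulrDl.
  rewrite big_split /=; congr (_ + _).
    rewrite (bigD1 j0) //= big1 => [|j jj0]; last by rewrite !mxE (negPf jj0) mul0r.
    by rewrite !mxE eqxx addr0 invfM divfK.
  rewrite raddf_sum /= mulr_suml; apply: eq_bigr => j _.
  by rewrite !mxE intrM mulrAC.
set z := \sum_j _ => /eqP zp.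
(* Multiplying by [2 s] equates an odd integer with an even one. *)
have : (1 + 2 * z)%:~R = (2 * s%:Z * p i0 0)%:~R :> R.
  rewrite intrD !intrM -zp -[s%:Z%:~R]/(s%:R : R); field.
  by rewrite s_neq0.
by move=> /intr_inj; lia.
Qed.

End LiouvilleOpenSets.

Theorem theorem3 (R : realType) (m n : nat) (hm : (0 < m)%N) (hn : (0 < n)%N)
  (U : set 'M[R]_(m, n)) (hUopen : open U) (hU0 : U !=set0)
  (f : nat -> 'M[R]_(m, n) -> 'M[R]_(m, n))
  (hinj : forall k, {in U &, injective (f k)})
  (hcont : forall k, {within U, continuous (f k)}) :
  let S := U `&` (\bigcap_(k in [set: nat]) (f k @^-1` @Liouville_set R m n))
             `&` @Liouville_set R m n in
  Gdelta_in U S /\ dense_in U S.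
Proof.
(* Index 0 is the identity and accounts for the factor [Liouville_set] itself. *)
pose g k := if k is k'.+1 then f k' else id.
have gC k : {in U, continuous (g k)}.
  case: k => [A _|k]; first exact: cvg_id.
  by have := hcont k; rewrite continuous_open_subspace.
have gI k : {in U &, injective (g k)} by case: k => [|k]; [move=> ? ?|exact: hinj].
(* Intersecting with [U] makes the preimage open, as continuity is given only there. *)
pose O (kw : nat * (nat + 'cV[int]_n * 'cV[int]_m)) := U `&` g kw.1 @^-1` Liouville_cond kw.2.
move=> S.
have -> : S = U `&` \bigcap_(kw in [set: _]) O kw.
  rewrite /S Liouville_setE; apply/seteqP; split=> A.
    move=> [[UA fA] LA]; split=> // -[[|k] w] _; split=> //; first exact: LA.
    exact: (fA k I w I).
  move=> [UA OA]; split; [split=> // k _ w _|move=> w _].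
    by have [] := OA (k.+1, w) I.
  by have [] := OA (0%N, w) I.
apply: residual_in_open => // [[k w]|[k w] B oB B0 BU].
  rewrite openE => A [UA LA]; apply: filterI; first exact: open_nbhs_nbhs.
  apply: (gC k A); first by rewrite inE.
  by apply: open_nbhs_nbhs; split=> //; exact: open_Liouville_cond.
have [A [BA gA]] : B `&` g k @^-1` Liouville_cond w !=set0.
  apply: Liouville_cond_meets_image => //.
    by move=> A; rewrite inE => /BU UA; apply: gC; rewrite inE.
  by move=> A A'; rewrite !inE => /BU UA /BU UA'; apply: gI; rewrite inE.
by exists A; split=> //; split=> //; exact: BU.
Qed.
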